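(* Let $p,q,r$ be integers with $p$ even and $q,r$ odd, and let $(Y_0,T_0)$ be the 2-stranded tangle with marked boundary associated to the $(p,q,r)$ pretzel knot by removing a 3-ball meeting the knot in a trivial tangle (as specified in the context). Then the image of $R^n(Y_0,T_0)$ in the pillowcase $R(S^2,\{a,b,c,d\})$ is contained in the union of the two straight line segments $$\theta=\gamma(r+1)\quad\text{and}\quad\theta=\gamma(r+1)+\pi .$$
   Context: $SU(2)$ is identified with the unit quaternions; ''traceless'' means purely imaginary. The tangle. The $(p,q,r)$ pretzel knot $K\subset S^3$ consists of three vertical twisted bands (columns) placed side by side from left to right, having $p,q,r$ half twists respectively; the top right end of each column is joined by an arc to the top left end of the next (cyclically), and similarly at the bottom. Remove from $S^3$ a small 3-ball $Y_1$ which meets $K$ in two parallel vertical strands of the third column, located above its $r$ half twists; $Y_1\cap K=T_1$ is a trivial tangle. $(Y_0,T_0)$ is the complementary ball with the remaining part of $K$. On $S^2=\partial Y_0$ the four points of $K$ are: upper left $b$, upper right $a$, lower left $c$, lower right $d$; the same letters denote their meridians (base point in front of the plane, strands of the third column oriented downward there), so $\pi_1(S^2\setminus\{a,b,c,d\})=\langle a,b,c,d\mid ba=cd\rangle$, and in $\pi_1(Y_1\setminus T_1)$ one has $a=d$, $b=c$. The strands of $T_0$ join $a$ to $c$ and $b$ to $d$. The handedness convention for twists is that, if $(x,y)$ are the downward oriented meridians of the left and right strands of a column above one positive half twist, then those below it are $\sigma(x,y)=(y,\,y^{-1}xy)$ (and $\sigma^{-1}$ for a negative half twist). Equivalently, $\pi_1(Y_0\setminus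 T_0)$ is generated by $a,b,c,d,z$ with relations $ba=cd$, $y_px_q=1$, $y_qx_r=1$ (and, consequently, $y_rx_p=1$), where $(x_p,y_p)=\sigma^p(a^{-1},z)$, $(x_q,y_q)=\sigma^q(z^{-1},b^{-1})$, $(x_r,y_r)=\sigma^r(c,d)$; the meridians of $T_0$ are the conjugates of $a^{\pm1},b^{\pm1}$. Representation spaces. $R(Y_0,T_0)$ is the space of $SU(2)$ conjugacy classes of representations $\rho:\pi_1(Y_0\setminus T_0)\to SU(2)$ that are traceless, i.e. send every meridian of $T_0$ to a purely imaginary quaternion. $R(S^2,\{a,b,c,d\})$ is the analogous space for $\pi_1(S^2\setminus\{a,b,c,d\})$; the image in the pillowcase is the image under the restriction map $R(Y_0,T_0)\to R(S^2,\{a,b,c,d\})$. Binary dihedral group: $B=\{\cos x+\sin x\,\mathbf{k}\}\cup\{\cos y\,\mathbf{i}+\sin y\,\mathbf{j}\}\subset SU(2)$. A representation of $\pi_1(Y_0\setminus T_0)$ is traceless binary dihedral if its image lies in $B$ and it takes all meridians of $T_0$ into $\{\cos y\,\mathbf{i}+\sin y\,\mathbf{j}\}$. $R^{tbd}(Y_0,T_0)\subset R(Y_0,T_0)$ is the set of $SU(2)$ conjugacy classes of such representations, and $R^n(Y_0,T_0)=R(Y_0,T_0)\setminus R^{tbd}(Y_0,T_0)$. Pillowcase: the map $\mathbb{R}^2\to R(S^2,\{a,b,c,d\})$ taking $(\gamma,\theta)$ to the conjugacy class of $a\mapsto\mathbf{i},\ b\mapsto e^{\gamma\mathbf{k}}\mathbf{i},\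 c\mapsto e^{\theta\mathbf{k}}\mathbf{i},\ d\mapsto e^{(\theta-\gamma)\mathbf{k}}\mathbf{i}$ is a surjective quotient map, identifying $R(S^2,\{a,b,c,d\})$ with the quotient of $\mathbb{R}^2$ by $(\gamma,\theta)\sim\pm(\gamma+2\pi m,\theta+2\pi n)$, $m,n\in\mathbb{Z}$. The straight line segments in the claim are the images in this quotient of the indicated lines in $\mathbb{R}^2$. *)

(* Defs.v *)
From HB Require Import structures.
From mathcomp Require Import all_boot all_order all_algebra ring.
From mathcomp Require Import all_classical all_reals all_analysis.
Set Implicit Arguments.
Unset Strict Implicit.
Unset Printing Implicit Defensive.
Import Order.TTheory GRing.Theory Num.Theory.
Local Open Scope classical_set_scope.
Local Open Scope quotient_scope.
Local Open Scope ring_scope.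

(* [Quat a b c d] is $a + b\mathbf i + c\mathbf j + d\mathbf k$. *)
Record quat (R : realType) := Quat { qre : R; qi : R; qj : R; qk : R }.

HB.instance Definition _ (R : realType) := gen_eqMixin (quat R).
HB.instance Definition _ (R : realType) := gen_choiceMixin (quat R).

Section Quaternions.
Variable R : realType.
Implicit Types x y z : quat R.

Definition mulq x y : quat R :=
  let: Quat a b c d := x in
  let: Quat a' b' c' d' := y in
  Quat (a * a' - b * b' - c * c' - d * d')
       (a * b' + b * a' + c * d' - d * c')
       (a * c' - b * d' + c * a' + d * b')
       (a * d' + b * c' - c * b' + d * a').

Definition oneq : quat R := Quat 1 0 0 0.

Definition conjq x : quat R := let: Quat a b c d := x in Quat a (- b) (- c) (- d).

Definition sqnormq x : R :=
  let: Quat a b c d := x in a ^+ 2 + b ^+ 2 + c ^+ 2 + d ^+ 2.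

Lemma mulqA : associative mulq.
Proof. by move=> [a b c d] [e f g h] [k l m n] /=; congr Quat; ring. Qed.

Lemma mul1q : left_id oneq mulq.
Proof. by move=> [a b c d] /=; congr Quat; ring. Qed.

Lemma mulq1 : right_id oneq mulq.
Proof. by move=> [a b c d] /=; congr Quat; ring. Qed.

Lemma sqnormqM x y : sqnormq (mulq x y) = sqnormq x * sqnormq y.
Proof. by case: x y => [a b c d] [e f g h] /=; ring. Qed.

Lemma sqnorm_conjq x : sqnormq (conjq x) = sqnormq x.
Proof. by case: x => [a b c d] /=; ring. Qed.

Lemma sqnorm_oneq : sqnormq oneq = 1.
Proof. by rewrite /=; ring. Qed.

Lemma mul_conjq x : mulq (conjq x) x = Quat (sqnormq x) 0 0 0.
Proof. by case: x => [a b c d] /=; congr Quat; ring. Qed.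

Lemma mulq_conj x : mulq x (conjq x) = Quat (sqnormq x) 0 0 0.
Proof. by case: x => [a b c d] /=; congr Quat; ring. Qed.

End Quaternions.

Record SU2 (R : realType) := MkSU2 { quat_of :> quat R; _ : sqnormq quat_of == 1 }.

HB.instance Definition _ (R : realType) := [isSub for @quat_of R].
HB.instance Definition _ (R : realType) := [Choice of SU2 R by <:].

Section SU2Group.
Variable R : realType.
Implicit Types x y : SU2 R.

Lemma sqnorm_SU2 x : sqnormq x = 1.
Proof. exact/eqP/(valP x). Qed.

Fact mulSU2_subproof x y : sqnormq (mulq x y) == 1.
Proof. by rewrite sqnormqM !sqnorm_SU2 mulr1. Qed.

Fact invSU2_subproof x : sqnormq (conjq x) == 1.
Proof. by rewrite sqnorm_conjq sqnorm_SU2. Qed.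

Fact oneSU2_subproof : sqnormq (oneq R) == 1.
Proof. by rewrite sqnorm_oneq. Qed.

Definition mulSU2 x y := MkSU2 (mulSU2_subproof x y).
Definition invSU2 x := MkSU2 (invSU2_subproof x).
Definition oneSU2 := MkSU2 oneSU2_subproof.

Lemma mulSU2A : associative mulSU2.
Proof. by move=> x y z; apply: val_inj; exact: mulqA. Qed.

Lemma mul1SU2 : left_id oneSU2 mulSU2.
Proof. by move=> x; apply: val_inj; exact: mul1q. Qed.

Lemma mulSU21 : right_id oneSU2 mulSU2.
Proof. by move=> x; apply: val_inj; exact: mulq1. Qed.

Lemma mulVSU2 : left_inverse oneSU2 invSU2 mulSU2.
Proof. by move=> x; apply: val_inj; apply: (etrans (mul_conjq _)); rewrite sqnorm_SU2. Qed.

Lemma mulSU2V : right_inverse oneSU2 invSU2 mulSU2.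
Proof. by move=> x; apply: val_inj; apply: (etrans (mulq_conj _)); rewrite sqnorm_SU2. Qed.

HB.instance Definition _ :=
  isGroup.Build (SU2 R) mulSU2A mul1SU2 mulSU21 mulVSU2 mulSU2V.

Fact expk_subproof (t : R) : sqnormq (Quat (cos t) 0 0 (sin t)) == 1.
Proof. by rewrite /= !expr0n /= !addr0 cos2Dsin2. Qed.

Fact circij_subproof (t : R) : sqnormq (Quat 0 (cos t) (sin t) 0) == 1.
Proof. by rewrite /= !expr0n /= add0r addr0 cos2Dsin2. Qed.

Fact quat_i_subproof : sqnormq (Quat 0 1 0 0 : quat R) == 1.
Proof. by rewrite /= !expr0n /= expr1n add0r !addr0. Qed.

(* [expk t] is $e^{t\mathbf k} = \cos t + \sin t\,\mathbf k$. *)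
Definition expk (t : R) : SU2 R := MkSU2 (expk_subproof t).
Definition circij (t : R) : SU2 R := MkSU2 (circij_subproof t).
Definition quat_i : SU2 R := MkSU2 quat_i_subproof.

Definition binary_dihedral : set (SU2 R) := range expk `|` range circij.

Lemma expk_mul_i (t : R) : (expk t * quat_i)%g = circij t.
Proof. by apply: val_inj => /=; congr Quat; ring. Qed.

End SU2Group.

(* Words in the letters [x^{+1} = (x, true)] and [x^{-1} = (x, false)]; they   *)
(* are not reduced, so this is only a *-monoid and the group axiom is imposed *)
(* in [word_eq].                                                             *)
Definition word (X : choiceType) := seq (X * bool).

Section Words.
Variable X : choiceType.
Implicit Types u v w : word X.

Definition letter (x : X) : word X := [:: (x, true)].
Definition invw w : word X := rev [seq (l.1, ~~ l.2) | l <- w].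

Lemma invwK : involutive invw.
Proof.
move=> w; rewrite /invw map_rev revK -map_comp map_id_in // => -[x e] _ /=.
by rewrite negbK.
Qed.

Lemma invwM : {morph invw : u v / u ++ v >-> v ++ u}.
Proof. by move=> u v; rewrite /invw map_cat rev_cat. Qed.

HB.instance Definition _ := Choice.on (word X).
HB.instance Definition _ :=
  isStarMonoid.Build (word X) (@catA _) (@cat0s _) invwK invwM.

Definition eval_word (H : groupType) (f : X -> H) (w : word X) : H :=
  (\prod_(l <- w) if l.2 then f l.1 else (f l.1)^-1)%g.

Lemma eval_word1 (H : groupType) (f : X -> H) : eval_word f 1%g = 1%g.
Proof. by rewrite /eval_word big_nil. Qed.

Lemma eval_wordM (H : groupType) (f : X -> H) u v :
  eval_word f (u * v)%g = (eval_word f u * eval_word f v)%g.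
Proof. by rewrite /eval_word big_cat. Qed.

Lemma eval_letter (H : groupType) (f : X -> H) x : eval_word f (letter x) = f x.
Proof. by rewrite /eval_word big_seq1. Qed.

Lemma eval_wordV (H : groupType) (f : X -> H) u :
  eval_word f (u^-1)%g = ((eval_word f u)^-1)%g.
Proof.
elim: u => [|[x e] u IHu]; first by rewrite [(_^-1)%g]/(1%g : word X) eval_word1 invg1.
rewrite -[(x, e) :: u]/(([:: (x, e)] : word X) * u)%g invgM !eval_wordM IHu invgM.
congr (_ * _)%g; rewrite /eval_word !big_seq1 /=.
by case: e => //=; rewrite invgK.
Qed.

End Words.

Section PresentedGroup.
Variables (X : choiceType) (rels : seq (word X * word X)).

Inductive word_eq : word X -> word X -> Prop :=
| word_eq_rel u v : (u, v) \in rels -> word_eq u v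
| word_eq_cancel u : word_eq (u^-1 * u)%g 1%g
| word_eq_refl u : word_eq u u
| word_eq_sym u v : word_eq u v -> word_eq v u
| word_eq_trans v u w : word_eq u v -> word_eq v w -> word_eq u w
| word_eq_mul u u' v v' :
    word_eq u u' -> word_eq v v' -> word_eq (u * v)%g (u' * v')%g.

Definition word_eqb (u v : word X) : bool := `[< word_eq u v >].

Lemma word_eqb_refl : reflexive word_eqb.
Proof. by move=> u; apply/asboolP/word_eq_refl. Qed.

Lemma word_eqb_sym : symmetric word_eqb.
Proof. by move=> u v; apply/asboolP/asboolP => /word_eq_sym. Qed.

Lemma word_eqb_trans : transitive word_eqb.
Proof. by move=> v u w /asboolP h /asboolP k; apply/asboolP/(word_eq_trans h k). Qed.

Canonical word_equiv := EquivRel word_eqb word_eqb_refl word_eqb_sym word_eqb_trans.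

(* The group with generators [X] and relations [u = v] for [(u, v) \in rels]. *)
Definition presented := {eq_quot word_equiv}.
HB.instance Definition _ := Choice.on presented.
HB.instance Definition _ := EqQuotient.on presented.

Local Notation cl := (\pi_presented : word X -> presented).

Lemma presentedP u v : (cl u = cl v) <-> word_eq u v.
Proof. by split=> [/eqmodP/asboolP|h] //; apply/eqmodP/asboolP. Qed.

Lemma word_eq_repr u : word_eq (repr (cl u)) u.
Proof. by apply/presentedP; rewrite reprK. Qed.

Lemma word_eqV u v : word_eq u v -> word_eq (u^-1)%g (v^-1)%g.
Proof.
move=> h.
have cR w : word_eq (w * w^-1)%g 1%g by have := word_eq_cancel (w^-1)%g; rewrite invgK.
apply: (@word_eq_trans (u^-1 * (v * v^-1))%g).
  rewrite -{1}[(u^-1)%g]mulg1; apply: word_eq_mul; first exact: word_eq_refl.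
  exact/word_eq_sym/cR.
rewrite mulgA -{2}[(v^-1)%g]mul1g; apply: word_eq_mul; last exact: word_eq_refl.
apply: word_eq_trans (word_eq_cancel u).
by apply: word_eq_mul; [exact: word_eq_refl | exact: word_eq_sym].
Qed.

Definition mulp (x y : presented) : presented := cl (repr x * repr y)%g.
Definition onep : presented := cl 1%g.
Definition invp (x : presented) : presented := cl ((repr x)^-1)%g.

Lemma mulp_pi u v : mulp (cl u) (cl v) = cl (u * v)%g.
Proof. by apply/presentedP/word_eq_mul; exact: word_eq_repr. Qed.

Lemma invp_pi u : invp (cl u) = cl (u^-1)%g.
Proof. by apply/presentedP/word_eqV; exact: word_eq_repr. Qed.

Lemma mulpA : associative mulp.
Proof.
by elim/quotW=> u; elim/quotW=> v; elim/quotW=> w; rewrite (mulp_pi v w) (mulp_pi u v) !mulp_pi mulgA.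
Qed.

Lemma mul1p : left_id onep mulp.
Proof. by elim/quotW=> u; rewrite mulp_pi mul1g. Qed.

Lemma mulp1 : right_id onep mulp.
Proof. by elim/quotW=> u; rewrite mulp_pi mulg1. Qed.

Lemma mulVp : left_inverse onep invp mulp.
Proof.
by elim/quotW=> u; rewrite invp_pi mulp_pi; apply/presentedP/word_eq_cancel.
Qed.

Lemma mulpV : right_inverse onep invp mulp.
Proof.
elim/quotW=> u; rewrite invp_pi mulp_pi; apply/presentedP.
by have := word_eq_cancel (u^-1)%g; rewrite invgK.
Qed.

HB.instance Definition _ := isGroup.Build presented mulpA mul1p mulp1 mulVp mulpV.

Definition gen (x : X) : presented := cl (letter x).

Lemma piM u v : cl (u * v)%g = (cl u * cl v)%g. Proof. by rewrite -mulp_pi. Qed.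
Lemma piV u : cl (u^-1)%g = ((cl u)^-1)%g. Proof. by rewrite -invp_pi. Qed.

Section UniversalProperty.
Variables (H : groupType) (f : X -> H).
Definition satisfies_rels :=
  forall u v, (u, v) \in rels -> eval_word f u = eval_word f v.

Lemma eval_word_eq : satisfies_rels ->
  forall u v, word_eq u v -> eval_word f u = eval_word f v.
Proof.
move=> Hf u v; elim=> {u v} //.
- by move=> u; rewrite eval_wordM eval_wordV mulVg eval_word1.
- by move=> v u w _ -> _ ->.
- by move=> u u' v v' _ h _ k; rewrite !eval_wordM h k.
Qed.

Definition pres_lift (Hf : satisfies_rels) (x : presented) : H := eval_word f (repr x).

Variable Hf : satisfies_rels.

Lemma pres_lift_pi u : pres_lift Hf (cl u) = eval_word f u.
Proof. exact: (eval_word_eq Hf (word_eq_repr u)). Qed.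

Lemma pres_lift_gen x : pres_lift Hf (gen x) = f x.
Proof. by rewrite pres_lift_pi eval_letter. Qed.

Lemma pres_lift_mul : {morph pres_lift Hf : x y / (x * y)%g}.
Proof.
by elim/quotW=> u; elim/quotW=> v; rewrite -piM !pres_lift_pi eval_wordM.
Qed.

HB.instance Definition _ := isMultiplicative.Build presented H (pres_lift Hf) pres_lift_mul.

End UniversalProperty.
End PresentedGroup.

(* The half twist action on pairs of meridians and its inverse, stated for    *)
(* words as well as for elements of a group.                                 *)
Definition sigma (G : baseGroupType) (xy : G * G) : G * G :=
  (xy.2, (xy.2^-1 * xy.1 * xy.2)%g).
Definition sigmaV (G : baseGroupType) (xy : G * G) : G * G :=
  ((xy.1 * xy.2 * xy.1^-1)%g, xy.1).

Definition sigma_pow (G : baseGroupType) (n : int) (xy : G * G) : G * G :=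
  match n with
  | Posz m => iter m (@sigma G) xy
  | Negz m => iter m.+1 (@sigmaV G) xy
  end.

Lemma sigmaK (G : groupType) : cancel (@sigma G) (@sigmaV G).
Proof. by move=> [x y]; rewrite /sigmaV /= !mulgA mulgV mul1g mulgK. Qed.

Lemma sigmaVK (G : groupType) : cancel (@sigmaV G) (@sigma G).
Proof. by move=> [x y]; rewrite /sigma /= !mulgA mulVg mul1g mulgVK. Qed.

Inductive s2gen := Sa | Sb | Sc | Sd.
HB.instance Definition _ := gen_eqMixin s2gen.
HB.instance Definition _ := gen_choiceMixin s2gen.

Definition s2_rels : seq (word s2gen * word s2gen) :=
  [:: ((letter Sb * letter Sa)%g, (letter Sc * letter Sd)%g)].

(* $\pi_1(S^2 \setminus \{a,b,c,d\})$. *)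
Definition pi1_S2 := presented s2_rels.

Inductive y0gen := Ya | Yb | Yc | Yd | Yz.
HB.instance Definition _ := gen_eqMixin y0gen.
HB.instance Definition _ := gen_choiceMixin y0gen.

(* The third gluing relation [xyr.2 * xyp.1 = 1] is a consequence of these,   *)
(* since [sigma] preserves the product of the pair.                          *)
Definition y0_rels (p q r : int) : seq (word y0gen * word y0gen) :=
  let a := letter Ya in let b := letter Yb in
  let c := letter Yc in let d := letter Yd in let z := letter Yz in
  let xyp := sigma_pow p (a^-1, z)%g in
  let xyq := sigma_pow q (z^-1, b^-1)%g in
  let xyr := sigma_pow r (c, d) in
  [:: ((b * a)%g, (c * d)%g); ((xyp.2 * xyq.1)%g, 1%g); ((xyq.2 * xyr.1)%g, 1%g)].

(* $\pi_1(Y_0 \setminus T_0)$. *)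
Definition pi1_Y0 (p q r : int) := presented (y0_rels p q r).

Definition s2_in_y0 (x : s2gen) : y0gen :=
  match x with Sa => Ya | Sb => Yb | Sc => Yc | Sd => Yd end.

Fact incl_subproof (p q r : int) :
  satisfies_rels s2_rels (fun x => gen (y0_rels p q r) (s2_in_y0 x)).
Proof.
move=> u v; rewrite inE => /eqP[-> ->].
rewrite !eval_wordM !eval_letter /= /gen -!piM.
by apply/presentedP/word_eq_rel; rewrite inE eqxx.
Qed.

Definition incl (p q r : int) : {multiplicative pi1_S2 -> pi1_Y0 p q r} :=
  pres_lift (@incl_subproof p q r).

Definition meridians (G : groupType) (S : set G) : set G :=
  [set m | exists x g, S x /\ (m = x ^ g \/ m = x^-1 ^ g)%g].

Definition meridians_S2 : set pi1_S2 := meridians (range (gen s2_rels)).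

(* One generator for each of the two strands, which join $a$ to $c$ and $b$   *)
(* to $d$.                                                                   *)
Definition meridians_Y0 (p q r : int) : set (pi1_Y0 p q r) :=
  meridians [set gen (y0_rels p q r) Ya; gen (y0_rels p q r) Yb].

Section Representations.
Variable R : realType.

Definition rep (G : groupType) := {multiplicative G -> SU2 R}.

Lemma rep_ext (G : groupType) (rho rho' : rep G) : rho =1 rho' -> rho = rho'.
Proof.
move=> /funext; case: rho rho' => [f [[mf]]] [g [[mg]]] /= fg.
by rewrite -fg in mg *; rewrite (Prop_irrelevance mf mg).
Qed.

Section Classes.
Variables (G : groupType) (M : set G).

(* Points of a space of representations up to conjugacy are the conjugacy     *)
(* classes themselves, as sets of representations.                           *)
Definition conj_class (rho : rep G) : set (rep G) :=
  [set rho' | exists g : SU2 R, forall x, rho' x = (rho x ^ g)%g].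

Definition conj_fun (rho : rep G) (g : SU2 R) (x : G) : SU2 R := (rho x ^ g)%g.

Fact conj_fun_mul rho g : {morph conj_fun rho g : x y / (x * y)%g}.
Proof. by move=> x y; rewrite /conj_fun gmulfM conjMg. Qed.

HB.instance Definition _ rho g :=
  isMultiplicative.Build G (SU2 R) (conj_fun rho g) (conj_fun_mul rho g).

Definition traceless (rho : rep G) : Prop := forall m, M m -> qre (rho m) = 0.

Definition binary_dihedral_rep (rho : rep G) : Prop :=
  range rho `<=` @binary_dihedral R /\ rho @` M `<=` range (@circij R).

Definition R_traceless : set (set (rep G)) := conj_class @` traceless.

Definition R_tbd : set (set (rep G)) := conj_class @` binary_dihedral_rep.

Definition R_n : set (set (rep G)) := R_traceless `\` R_tbd.

End Classes.

Definition R_S2 : set (set (rep pi1_S2)) := R_traceless meridians_S2.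

Definition Rn_Y0 (p q r : int) : set (set (rep (pi1_Y0 p q r))) :=
  R_n (@meridians_Y0 p q r).

Definition restrict (p q r : int) (rho : rep (pi1_Y0 p q r)) : rep pi1_S2 :=
  rho \o incl p q r.

(* The restrictions of the members of a class already form a full class,     *)
(* cf. [restrict_class_conj].                                                *)
Definition restrict_class (p q r : int) (C : set (rep (pi1_Y0 p q r))) :
  set (rep pi1_S2) := @restrict p q r @` C.

Lemma restrict_class_conj (p q r : int) (rho : rep (pi1_Y0 p q r)) :
  restrict_class (conj_class rho) = conj_class (restrict rho).
Proof.
apply/seteqP; split=> [_ [rho' [g rho'E] <-]|rho' [g rho'E]].
  by exists g => x; exact: rho'E.
exists (conj_fun rho g : rep _); first by exists g.
by apply: rep_ext => x; rewrite rho'E.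
Qed.

Definition pillow_gen (gt : R * R) (x : s2gen) : SU2 R :=
  match x with
  | Sa => quat_i R
  | Sb => (expk gt.1 * quat_i R)%g
  | Sc => (expk gt.2 * quat_i R)%g
  | Sd => (expk (gt.2 - gt.1) * quat_i R)%g
  end.

Fact pillow_subproof (gt : R * R) : satisfies_rels s2_rels (pillow_gen gt).
Proof.
move=> u v; rewrite inE => /eqP[-> ->]; rewrite !eval_wordM !eval_letter /=.
rewrite !expk_mul_i; case: gt => g t /=; apply: val_inj => /=.
rewrite sinB cosB.
have e := cos2Dsin2 t; have es : sin t ^+ 2 = 1 - cos t ^+ 2 by rewrite -e; ring.
by congr Quat; ring: es.
Qed.

Definition pillow_rep (gt : R * R) : rep pi1_S2 := pres_lift (pillow_subproof gt).

(* The quotient map $\mathbb R^2 \to R(S^2,\{a,b,c,d\})$. *)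
Definition pillow (gt : R * R) : set (rep pi1_S2) := conj_class (pillow_rep gt).

Lemma pillow_in_R_S2 (gt : R * R) : R_S2 (pillow gt).
Proof.
exists (pillow_rep gt) => // m [_ [g [[x _ <-] mE]]].
have J (y h : SU2 R) : qre (y ^ h)%g = qre y.
  have nh := sqnorm_SU2 h; rewrite -[RHS]mul1r -nh.
  by case: y h {nh} => [[? ? ? ?] ?] [[? ? ? ?] ?] /=; ring.
have V (y : SU2 R) : qre (y^-1)%g = qre y by case: y => [[]].
have rhoM : {morph pillow_rep gt : x y / (x * y)%g} by move=> y h; rewrite gmulfM.
have rho1 : pillow_rep gt 1%g = 1%g.
  by apply: (@mulgI _ (pillow_rep gt 1%g)); rewrite -rhoM !mulg1.
have rhoV y : pillow_rep gt (y^-1)%g = ((pillow_rep gt y)^-1)%g.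
  by apply: (@mulgI _ (pillow_rep gt y)); rewrite -rhoM !mulgV.
have rho_gen : qre (pillow_rep gt (gen s2_rels x)) = 0.
  rewrite [pillow_rep gt _](pres_lift_gen (pillow_subproof gt)).
  by case: x {mE} => /=; rewrite ?expk_mul_i //=; ring.
by case: mE => ->; rewrite /conjg !rhoM !rhoV -conjgE J ?V.
Qed.

End Representations.

Arguments R_S2 : clear implicits.
Arguments Rn_Y0 : clear implicits.
Arguments restrict_class R {p q r} C.

(* Main.v *)
Require Import Defs.
From mathcomp Require Import all_boot all_order all_algebra.
From mathcomp Require Import all_classical all_reals all_analysis.
From mathcomp Require Import zify ring lra.
Set Implicit Arguments.
Unset Strict Implicit.
Unset Printing Implicit Defensive.
Import Order.TTheory GRing.Theory Num.Theory.
Local Open Scope classical_set_scope.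
Local Open Scope ring_scope.

(** Let [rho] be a traceless representation. The parities of [p], [q], [r] make
    [c], [d] and [z] conjugate to [a^+-1] or [b^+-1], so all five generators go
    to imaginary unit quaternions ([traceless_generators]). The relation
    [ba = cd] then says that the real part of [c^-1 b a] vanishes; this is the
    triple product of [a], [b], [c], so these are coplanar, and after a
    conjugation [a = i] and [b], [c], [d] lie on the circle of unit quaternions
    in the i,j-plane ([pillowcase_position]), at angles [gamma], [theta] and
    [theta - gamma].

    On this circle the half twist acts affinely on angles
    ([sigma_pow_circij]), so the lower right meridian [y_r] of the third column
    sits at angle [theta - (r + 1) gamma]. It is glued to the first column:
    [x_p = y_r^-1]. On the other hand a half twist turns one meridian of a pair
    by a half turn about the other, so [x_p] stays in the plane spanned by [a]
    and [z] ([sigma_pow_plane]).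

    If [z] lies in the i,j-plane, all generators are on the circle and [rho] is
    binary dihedral ([circij_gens_binary_dihedral]), which is excluded.
    Otherwise the span of [a = i] and [z] meets the i,j-plane in the line of
    [i] alone. As [x_p] is in both, [y_r] is [i] or [-i], that is,
    [sin (theta - (r + 1) gamma) = 0] ([sin_right_column_angle]): these are
    the two lines of the theorem. *)

(** * Angles *)

Lemma unit_circle_angle (R : realType) (x y : R) :
  x ^+ 2 + y ^+ 2 = 1 -> exists t, x = cos t /\ y = sin t.
Proof.
move=> xy.
have x1 : -1 <= x <= 1 by apply/andP; split; nra.
have y2 : 1 - x ^+ 2 = y ^+ 2 by rewrite -xy addrC addKr.
have [y0|y0] := leP 0 y; [exists (acos x)|exists (- acos x)].
  by rewrite acosK // sin_acos // y2 sqrtr_sqr ger0_norm.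
by rewrite cosN sinN acosK // sin_acos // y2 sqrtr_sqr ltr0_norm // opprK.
Qed.

Lemma polar (R : realType) (x y : R) :
  exists n t, x = n * cos t /\ y = n * sin t.
Proof.
have [/eqP n0|n0] := eqVneq (x ^+ 2 + y ^+ 2) 0.
  move: n0; rewrite paddr_eq0 ?sqr_ge0 // !sqrf_eq0 => /andP[/eqP-> /eqP->].
  by exists 0, 0; rewrite !mul0r.
set s := Num.sqrt (x ^+ 2 + y ^+ 2).
have s2 : s ^+ 2 = x ^+ 2 + y ^+ 2 by rewrite sqr_sqrtr // addr_ge0 // sqr_ge0.
have s0 : s != 0 by rewrite -sqrf_eq0 s2.
have [|t [xt yt]] := @unit_circle_angle R (x / s) (y / s).
  by rewrite !expr_div_n -mulrDl -s2 divff // sqrf_eq0.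
by exists s, t; rewrite -xt -yt; split; field.
Qed.

(** * Unit quaternions and the binary dihedral group *)

Section Quaternions.
Variable R : realType.
Implicit Types (x y z g : SU2 R) (s t u v : R).

Lemma SU2_inj x y : qre x = qre y -> qi x = qi y -> qj x = qj y ->
  qk x = qk y -> x = y.
Proof.
by case: x y => [[? ? ? ?] ?] [[? ? ? ?] ?] /= *; apply: val_inj => /=; congr Quat.
Qed.

Lemma sqnormE x : qre x ^+ 2 + qi x ^+ 2 + qj x ^+ 2 + qk x ^+ 2 = 1.
Proof. by rewrite -(sqnorm_SU2 x); case: x => [[]]. Qed.

Lemma qreJ x g : qre (x ^ g)%g = qre x.
Proof.
have nh := sqnorm_SU2 g; rewrite -[RHS]mul1r -nh.
by case: x g {nh} => [[? ? ? ?] ?] [[? ? ? ?] ?] /=; ring.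
Qed.

Lemma qreV x : qre (x^-1)%g = qre x.
Proof. by case: x => [[]]. Qed.

Definition dotq x y := qi x * qi y + qj x * qj y + qk x * qk y.

(** Conjugation by an imaginary unit [y] is the half turn about the line of
    [y]. *)
Lemma conj_traceless x y : qre x = 0 -> qre y = 0 ->
  [/\ qre (y^-1 * x * y)%g = 0,
      qi (y^-1 * x * y)%g = 2 * dotq x y * qi y - qi x,
      qj (y^-1 * x * y)%g = 2 * dotq x y * qj y - qj x
    & qk (y^-1 * x * y)%g = 2 * dotq x y * qk y - qk x].
Proof.
move=> x0 y0; have := sqnormE y; rewrite /dotq.
case: x y x0 y0 => [[x0 x1 x2 x3] ?] [[y0 y1 y2 y3] ?] /= -> -> n.
have e : y1 ^+ 2 = 1 - y2 ^+ 2 - y3 ^+ 2 by rewrite -n; ring.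
by split; ring: e.
Qed.

Lemma traceless_invJ x y : qre x = 0 -> (x * y * x^-1 = x^-1 * y * x)%g.
Proof.
case: x y => [[x0 x1 x2 x3] ?] [[y0 y1 y2 y3] ?] /= xre.
by apply: val_inj; rewrite /= xre; congr Quat; ring.
Qed.

(** Being on the circle is a pair of linear conditions, which turns membership
    questions about [circij], [expk] and [binary_dihedral] into polynomial
    identities between coordinates. *)
Lemma circijP x : range (@circij R) x <-> qre x = 0 /\ qk x = 0.
Proof.
split=> [[t _ <-] //|[x0 x3]]; have := sqnormE x.
rewrite x0 x3 !expr0n /= add0r addr0 => /unit_circle_angle[t [x1 x2]].
by exists t => //; apply: SU2_inj.
Qed.

Lemma expkP x : range (@expk R) x <-> qi x = 0 /\ qj x = 0.
Proof.
split=> [[t _ <-] //|[x1 x2]]; have := sqnormE x.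
rewrite x1 x2 !expr0n /= !addr0 => /unit_circle_angle[t [x0 x3]].
by exists t => //; apply: SU2_inj.
Qed.

Lemma binary_dihedralP x : binary_dihedral x <->
  (qi x = 0 /\ qj x = 0) \/ (qre x = 0 /\ qk x = 0).
Proof.
by split=> -[]; [move/expkP|move/circijP|move/expkP|move/circijP]; by [left|right].
Qed.

Lemma binary_dihedralM x y :
  binary_dihedral x -> binary_dihedral y -> binary_dihedral (x * y)%g.
Proof.
move=> /binary_dihedralP hx /binary_dihedralP hy; apply/binary_dihedralP.
case: x y hx hy => [[x0 x1 x2 x3] ?] [[y0 y1 y2 y3] ?] /=.
by case=> -[-> ->] [] [-> ->]; [left|right|right|left]; split; ring.
Qed.

Lemma binary_dihedralV x : binary_dihedral x -> binary_dihedral (x^-1)%g.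
Proof.
move=> /binary_dihedralP hx; apply/binary_dihedralP.
by case: x hx => [[x0 x1 x2 x3] ?] /= [] [-> ->]; [left|right]; rewrite !oppr0.
Qed.

Lemma circijJ x g : range (@circij R) x -> binary_dihedral g ->
  range (@circij R) (x ^ g)%g.
Proof.
move=> /circijP hx /binary_dihedralP hg; apply/circijP.
case: x g hx hg => [[x0 x1 x2 x3] ?] [[y0 y1 y2 y3] ?] /= [-> ->].
by case=> -[-> ->]; split; ring.
Qed.

Lemma circijV x : range (@circij R) x -> range (@circij R) (x^-1)%g.
Proof.
move=> /circijP hx; apply/circijP.
by case: x hx => [[x0 x1 x2 x3] ?] /= [-> ->]; rewrite oppr0.
Qed.

Lemma circij_conj u v :
  ((circij v)^-1 * circij u * circij v)%g = circij (2 * v - u).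
Proof.
have es := sin2cos2 v.
apply: val_inj => /=.
rewrite sinB cosB !(mulrC 2) mulr_natr cos_mulr2n sin_mulr2n.
by congr Quat; ring: es.
Qed.

(** * The pillowcase normal form *)

Fact expi_subproof t : sqnormq (Quat (cos t) (sin t) 0 0) == 1.
Proof. by rewrite /= !expr0n /= !addr0 cos2Dsin2. Qed.

Definition expi t := MkSU2 (expi_subproof t).

(** The half angle appears because conjugation by [e^(t/2 i)] rotates the
    j,k-plane by an angle [t]. *)
Lemma qk_expiJ x t :
  qk (x ^ expi (t / 2))%g = cos t * qk x - sin t * qj x.
Proof.
rewrite -[in RHS](divfK (_ : 2 != 0) t) // mulr_natr cos_mulr2n sin_mulr2n.
case: x => [[? ? ? ?] ?] /=.
have es := sin2cos2 (t / 2).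
by ring: es.
Qed.

Lemma expkJ_circij t u : (circij u ^ expk t)%g = circij (u - 2 * t).
Proof.
apply: val_inj => /=.
rewrite sinB cosB !(mulrC 2) mulr_natr cos_mulr2n sin_mulr2n.
have es := sin2cos2 t.
by congr Quat; ring: es.
Qed.

(** A rotation about the first axis brings [x] into the i,j-plane, and a
    rotation about the third axis then brings it to [i]. *)
Lemma traceless_conj_i x : qre x = 0 -> exists g, (x ^ g)%g = quat_i R.
Proof.
move=> x0; have [n [t [x2 x3]]] := polar (qj x) (qk x).
have /circijP[u _ xu] : qre (x ^ expi (t / 2))%g = 0 /\ qk (x ^ expi (t / 2))%g = 0.
  by rewrite qreJ qk_expiJ x2 x3; split=> //; ring.
exists (expi (t / 2) * expk (u / 2))%g.
rewrite conjgM -xu expkJ_circij mulrC divfK // subrr.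
by apply: SU2_inj; rewrite /= ?cos0 ?sin0.
Qed.

(** The equation is the vanishing of the triple product of [i], [x] and [y]:
    these three lie in a plane through [i], which a rotation about [i] moves to
    the i,j-plane. *)
Lemma coplanar_rotation x y : qre x = 0 -> qre y = 0 ->
  qj x * qk y = qk x * qj y ->
  exists g, [/\ (quat_i R ^ g)%g = quat_i R, range (@circij R) (x ^ g)%g
             & range (@circij R) (y ^ g)%g].
Proof.
move=> x0 y0 xy.
suff [t [xt yt]] : exists t : R, cos t * qk x - sin t * qj x = 0 /\
    cos t * qk y - sin t * qj y = 0.
  exists (expi (t / 2)); split; last 2 first.
  - by apply/circijP; rewrite qreJ qk_expiJ.
  - by apply/circijP; rewrite qreJ qk_expiJ.
  apply: val_inj; rewrite /=.
  have es := sin2cos2 (t / 2).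
  by congr Quat; ring: es.
(* The angle of the j,k-part of [x] serves for [y] too, as these parts are
   parallel; if that of [x] vanishes, the angle is taken from [y]. *)
have [n [t [x2 x3]]] := polar (qj x) (qk x).
have [n0|n0] := eqVneq n 0.
  have [m [s [y2 y3]]] := polar (qj y) (qk y).
  by exists s; rewrite x2 x3 y2 y3 n0; split; ring.
exists t; split; first by rewrite x2 x3; ring.
by apply: (mulfI n0); rewrite mulrBr !mulrA -x2 -x3 xy mulr0 subrr.
Qed.

(** This is the surjectivity of the pillowcase parametrisation: the last
    hypothesis is the tracelessness of [d = z^-1 y x] in the group of the
    four-punctured sphere, where [x], [y], [z] stand for [a], [b], [c]. *)
Lemma pillowcase_position x y z :
  qre x = 0 -> qre y = 0 -> qre z = 0 -> qre (z^-1 * y * x)%g = 0 ->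
  exists g s t, [/\ (x ^ g)%g = quat_i R, (y ^ g)%g = circij s
                  & (z ^ g)%g = circij t].
Proof.
move=> x0 y0 z0 zyx0; have [g xg] := traceless_conj_i x0.
have e : qj (y ^ g)%g * qk (z ^ g)%g = qk (y ^ g)%g * qj (z ^ g)%g.
  have : qre ((z ^ g)^-1 * (y ^ g) * quat_i R)%g = 0.
    by rewrite -xg -conjVg -!conjMg qreJ.
  have := qreJ y g; have := qreJ z g; rewrite y0 z0.
  case: (y ^ g)%g (z ^ g)%g => [[? ? ? ?] ?] [[? ? ? ?] ?] /= -> -> h.
  by apply/eqP; rewrite eq_sym -subr_eq0; apply/eqP; rewrite -h; ring.
have [||h [ih [s _ ys] [t _ zt]]] := coplanar_rotation _ _ e; rewrite ?qreJ //.
by exists (g * h)%g, s, t; rewrite !conjgM xg ih ys zt.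
Qed.

End Quaternions.

(** * Half twists *)

(** Powers of [sigma] are iterates of one of two different maps according to
    sign; this induction treats both signs together, with an invariant that
    may depend on the exponent. *)
Lemma sigma_pow_ind (G : baseGroupType) (P : int -> G * G -> Prop) xy :
  P 0 xy ->
  (forall n w, P n w -> P (n + 1) (sigma w)) ->
  (forall n w, P n w -> P (n - 1) (sigmaV w)) ->
  forall n, P n (sigma_pow n xy).
Proof.
move=> P0 PS PV [m|m] /=.
  by elim: m => //= m /PS; rewrite -PoszD addn1.
elim: m => [|m /PV] /=; first exact: PV P0.
by rewrite !NegzE -opprD -PoszD addn1.
Qed.

Lemma eval_sigma_pow (X : choiceType) (H : groupType) (f : X -> H) n u v :
  (eval_word f (sigma_pow n (u, v)).1, eval_word f (sigma_pow n (u, v)).2)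
  = sigma_pow n (eval_word f u, eval_word f v).
Proof.
case: n => m; rewrite /sigma_pow; last rewrite !iterS;
  elim: m => [|m] //; rewrite ?iterS; try (move=> <-);
  by rewrite /sigma /sigmaV /= !(eval_wordM, eval_wordV).
Qed.

Lemma sigma_pow_prod (G : groupType) n (x y : G) :
  ((sigma_pow n (x, y)).1 * (sigma_pow n (x, y)).2 = x * y)%g.
Proof.
apply: (sigma_pow_ind (P := fun _ w => (w.1 * w.2 = x * y)%g)) => // _ [u v] /=.
  by rewrite !mulgA mulgV mul1g.
by rewrite mulgVK.
Qed.

Section SigmaSU2.
Variable R : realType.
Implicit Types (x y z : SU2 R) (s t u v : R) (n : int).

Lemma qre_conj x y : qre (y^-1 * x * y)%g = qre x.
Proof. by rewrite -mulgA -conjgE qreJ. Qed.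

Lemma qre_sigma_pow n x y :
  (qre (sigma_pow n (x, y)).1, qre (sigma_pow n (x, y)).2) =
  if (2 %| n)%Z then (qre x, qre y) else (qre y, qre x).
Proof.
pose P n (w : SU2 R * SU2 R) := (qre w.1, qre w.2) =
  if (2 %| n)%Z then (qre x, qre y) else (qre y, qre x).
apply: (sigma_pow_ind (P := P)) => // {}n [u v]; rewrite /P.
  have -> : qre (sigma (u, v)).2 = qre u by exact: qre_conj.
  have -> : (2 %| n + 1)%Z = ~~ (2 %| n)%Z by lia.
  by case: ifP => _ /= [-> ->].
have -> : qre (sigmaV (u, v)).1 = qre v.
  by have := qre_conj v (u^-1)%g; rewrite invgK.
have -> : (2 %| n - 1)%Z = ~~ (2 %| n)%Z by lia.
by case: ifP => _ /= [-> ->].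
Qed.

(** A half twist sends the angles [(u, v)] to [(v, 2 v - u)]: the difference is
    kept and both angles advance by it. *)
Lemma sigma_pow_circij n u v :
  sigma_pow n (circij u, circij v) =
  (circij (u + n%:~R * (v - u)), circij (v + n%:~R * (v - u))).
Proof.
pose P n (w : SU2 R * SU2 R) :=
  w = (circij (u + n%:~R * (v - u)), circij (v + n%:~R * (v - u))).
apply: (sigma_pow_ind (P := P)) => [|{}n _ ->|{}n _ ->]; rewrite /P.
- by rewrite !mul0r !addr0.
- by rewrite /sigma circij_conj intrD; congr (circij _, circij _); ring.
- rewrite /sigmaV traceless_invJ // circij_conj intrB.
  by congr (circij _, circij _); ring.
Qed.

(** The imaginary quaternions with [V] form a plane through [i] (when [s] and
    [t] are not both zero), and the half turn about a vector of a plane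
    preserves that plane. *)
Lemma sigma_pow_plane s t n x y :
  let V (w : SU2 R) := qre w = 0 /\ qj w * t = qk w * s in
  V x -> V y -> V (sigma_pow n (x, y)).1 /\ V (sigma_pow n (x, y)).2.
Proof.
move=> V Vx Vy; pose P (_ : int) (w : SU2 R * SU2 R) := V w.1 /\ V w.2.
have VJ (u v : SU2 R) : V u -> V v -> V (v^-1 * u * v)%g.
  move=> [u0 uV] [v0 vV]; have [w0 _ w2 w3] := conj_traceless u0 v0.
  by split=> //; rewrite w2 w3 !mulrBl -!mulrA vV uV.
apply: (sigma_pow_ind (P := P)) => // m [u v] [Vu Vv]; split=> //.
- exact: VJ.
- have -> : (sigmaV (u, v)).1 = (u^-1 * v * u)%g by apply: traceless_invJ; case: Vu.
  exact: VJ.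
Qed.

Lemma sin0_circij s t : sin (s - t) = 0 ->
  circij s = circij t \/ circij s = circij (t + pi).
Proof.
move=> st0; have := cos2Dsin2 (s - t); rewrite st0 expr0n addr0 /=.
have cs : cos s = cos (s - t) * cos t.
  by have := cosD (s - t) t; rewrite subrK st0 mul0r subr0.
have ss : sin s = cos (s - t) * sin t.
  by have := sinD (s - t) t; rewrite subrK st0 mul0r add0r.
move/eqP; rewrite sqrf_eq1 => /orP[]/eqP c1; [left|right];
  apply: SU2_inj => //=; rewrite ?cosDpi ?sinDpi ?cs ?ss c1; ring.
Qed.

End SigmaSU2.

(** * The gluing relations of the tangle in SU(2) *)

Section Core.
Variables (R : realType) (p q r : int) (a b c d z : SU2 R).
Hypothesis p_even : (2 %| p)%Z.
Hypothesis q_odd : ~~ (2 %| q)%Z.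
Hypothesis r_odd : ~~ (2 %| r)%Z.
Let xyp := sigma_pow p (a^-1, z)%g.
Let xyq := sigma_pow q (z^-1, b^-1)%g.
Let xyr := sigma_pow r (c, d).
Hypothesis ba_cd : (b * a = c * d)%g.
Hypothesis glue_pq : (xyp.2 * xyq.1 = 1)%g.
Hypothesis glue_qr : (xyq.2 * xyr.1 = 1)%g.
Hypotheses (a0 : qre a = 0) (b0 : qre b = 0).

(** [sigma] keeps the product of a pair, so the six meridians at the bottoms of
    the three columns multiply to [a^-1 z z^-1 b^-1 b a = 1]; the two given
    gluings cancel the inner four. *)
Lemma glue_rp : (xyr.2 * xyp.1 = 1)%g.
Proof.
have hp : (xyp.1 * xyp.2 = a^-1 * z)%g := sigma_pow_prod _ _ _.
have hq : (xyq.1 * xyq.2 = z^-1 * b^-1)%g := sigma_pow_prod _ _ _.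
have hr : (xyr.1 * xyr.2 = c * d)%g := sigma_pow_prod _ _ _.
have : (xyp.1 * xyr.2 = 1)%g.
  rewrite -[xyr.2]mul1g -glue_qr -[xyp.1]mulg1 -glue_pq.
  have -> : (xyp.1 * (xyp.2 * xyq.1) * (xyq.2 * xyr.1 * xyr.2) =
     (xyp.1 * xyp.2) * (xyq.1 * xyq.2) * (xyr.1 * xyr.2))%g by rewrite !mulgA.
  by rewrite hp hq hr -ba_cd !mulgA mulgK mulgVK mulVg.
by move=> /mulg1_eq <-; rewrite mulVg.
Qed.

(** An even power of [sigma] returns each strand to its side and an odd power
    exchanges the sides; real parts, being conjugation invariant, follow the
    strands. *)
Lemma traceless_generators : [/\ qre c = 0, qre d = 0 & qre z = 0].
Proof.
have := qre_sigma_pow p (a^-1)%g z; rewrite p_even -/xyp => -[xp yp].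
have := qre_sigma_pow q (z^-1)%g (b^-1)%g.
rewrite (negbTE q_odd) -/xyq => -[xq yq].
have := qre_sigma_pow r c d; rewrite (negbTE r_odd) -/xyr => -[xr yr].
have z0 : qre z = 0 by rewrite -yp -qreV (mulg1_eq glue_pq) xq qreV.
split=> //.
- by rewrite -yr -qreV (mulg1_eq glue_rp) xp qreV.
- by rewrite -xr -(mulg1_eq glue_qr) qreV yq qreV.
Qed.

Lemma pillow_d s t : a = quat_i R -> b = circij s -> c = circij t ->
  d = circij (t - s).
Proof.
move=> ai bs ct; apply: (@mulgI _ c); rewrite -ba_cd ai bs ct.
have := pillow_subproof (s, t) (mem_head _ _).
by rewrite !eval_wordM !eval_letter /= !expk_mul_i.
Qed.

(** [y_r] is on the circle and its inverse [x_p] lies in the plane of [i] and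
    [z]. If [z] leaves the i,j-plane, these two planes meet only in the line of
    [i], so the j-coordinate of [y_r], which is this sine, vanishes. *)
Lemma sin_right_column_angle s t : a = quat_i R -> b = circij s -> c = circij t ->
  qre z = 0 -> qk z != 0 -> sin (t - s * (r + 1)%:~R) = 0.
Proof.
move=> ai bs ct z0 z3; have ds := pillow_d ai bs ct.
have yr : xyr.2 = circij (t - s * (r + 1)%:~R).
  rewrite /xyr ct ds sigma_pow_circij /=; congr circij; rewrite intrD; ring.
have xpE : xyp.1 = (xyr.2^-1)%g by rewrite (mulg1_eq glue_rp).
have aV : qre (a^-1)%g = 0 /\ qj (a^-1)%g * qk z = qk (a^-1)%g * qj z.
  by rewrite ai /= !oppr0 !mul0r.
have zV : qre z = 0 /\ qj z * qk z = qk z * qj z by rewrite mulrC.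
have [[_ xpV] _] := sigma_pow_plane p aV zV.
move: xpV; rewrite -/xyp xpE yr /= oppr0 mul0r => /eqP.
by rewrite mulf_eq0 (negbTE z3) orbF oppr_eq0 => /eqP.
Qed.

End Core.

(** * Representations of presented groups *)

Lemma multiplicativeV (G H : groupType) (f : {multiplicative G -> H}) :
  {morph f : x / (x^-1)%g}.
Proof.
move=> x; apply: (@mulgI _ (f x)); rewrite -gmulfM !mulgV.
by apply: (@mulgI _ (f 1%g)); rewrite -gmulfM !mulg1.
Qed.

Section PresentedMorphisms.
Variables (X : choiceType) (rels : seq (word X * word X)) (H : groupType).
Implicit Types rho : {multiplicative presented rels -> H}.

Lemma morph_pi rho u :
  rho (\pi_(presented rels)%qT u) = eval_word (fun x => rho (gen rels x)) u.
Proof.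
elim: u => [|[x e] u IHu].
  by rewrite eval_word1; apply: (@mulgI _ (rho 1%g)); rewrite -gmulfM !mulg1.
rewrite -[(x, e) :: u]/(([:: (x, e)] : word X) * u)%g piM gmulfM eval_wordM IHu.
congr (_ * _)%g; rewrite /eval_word big_seq1 /=; case: e => //=.
by rewrite -multiplicativeV -piV.
Qed.

Lemma morph_satisfies_rels rho : satisfies_rels rels (fun x => rho (gen rels x)).
Proof.
by move=> u v uv; rewrite -!morph_pi; congr (rho _); apply/presentedP/word_eq_rel.
Qed.

Lemma morph_presented_ext rho rho' :
  (forall x, rho (gen rels x) = rho' (gen rels x)) -> rho =1 rho'.
Proof.
move=> gE; elim/quotW=> u; rewrite !morph_pi /eval_word.
by apply: eq_bigr => -[x e] _; rewrite gE.
Qed.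

End PresentedMorphisms.

Lemma pi1_Y0_relations (H : groupType) (p q r : int) (f : y0gen -> H) :
  satisfies_rels (y0_rels p q r) f ->
  let xyp := sigma_pow p ((f Ya)^-1, f Yz)%g in
  let xyq := sigma_pow q ((f Yz)^-1, (f Yb)^-1)%g in
  let xyr := sigma_pow r (f Yc, f Yd) in
  [/\ (f Yb * f Ya = f Yc * f Yd)%g, (xyp.2 * xyq.1 = 1)%g
    & (xyq.2 * xyr.1 = 1)%g].
Proof.
move=> S xyp xyq xyr.
have := eval_sigma_pow f p ((letter Ya)^-1)%g (letter Yz).
rewrite !eval_wordV !eval_letter -/xyp => pE.
have := eval_sigma_pow f q ((letter Yz)^-1)%g ((letter Yb)^-1)%g.
rewrite !eval_wordV !eval_letter -/xyq => qE.
have := eval_sigma_pow f r (letter Yc) (letter Yd).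
rewrite !eval_letter -/xyr => rE.
have Srel n : (n < size (y0_rels p q r))%N ->
    let uv := nth ([::], [::]) (y0_rels p q r) n in
    eval_word f uv.1 = eval_word f uv.2.
  by move=> /(mem_nth ([::], [::])) nS; apply: S; rewrite -surjective_pairing.
split.
- by have := S _ _ (mem_head _ _); rewrite !eval_wordM !eval_letter.
- rewrite -pE -qE -(eval_word1 f) -eval_wordM; exact: (Srel 1%N isT).
- rewrite -qE -rE -(eval_word1 f) -eval_wordM; exact: (Srel 2%N isT).
Qed.

Section Representations.
Variable R : realType.

Lemma conj_class_conj (G : groupType) (rho : rep R G) g :
  conj_class (conj_fun rho g : rep R G) = conj_class rho.
Proof.
apply/seteqP; split=> rho' [h hE].
  by exists (g * h)%g => x; rewrite hE conjgM.
by exists (g^-1 * h)%g => x; rewrite hE /= /conj_fun -conjgM mulVKg.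
Qed.

(** The binary dihedral group is closed under products and inverses, and
    conjugation by its elements preserves the circle. *)
Lemma circij_gens_binary_dihedral (p q r : int) (rho : rep R (pi1_Y0 p q r)) :
  (forall x, range (@circij R) (rho (gen (y0_rels p q r) x))) ->
  binary_dihedral_rep (@meridians_Y0 p q r) rho.
Proof.
move=> rhoC.
have rhoB x : binary_dihedral (rho x).
  elim/quotW: x => u; rewrite morph_pi /eval_word.
  apply: big_ind => [|x y|[x e] _ /=]; [|exact: binary_dihedralM|].
    by apply/binary_dihedralP; left.
  by case: e; [|apply: binary_dihedralV]; right.
split=> [_ [x _ <-] //|_ [m [x [g [xM mE]]] <-]].
have xC : range (@circij R) (rho x) by case: xM => ->.
have rhoJ y h : rho (y ^ h)%g = (rho y ^ rho h)%g.
  by rewrite !conjgE !gmulfM multiplicativeV.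
case: mE => ->; rewrite rhoJ; apply: circijJ => //.
by rewrite multiplicativeV; apply: circijV.
Qed.

Lemma restrict_class_pillow (p q r : int) (rho : rep R (pi1_Y0 p q r)) gt :
  (forall x, rho (gen (y0_rels p q r) (s2_in_y0 x)) = pillow_gen gt x) ->
  restrict_class R (conj_class rho) = pillow gt.
Proof.
move=> rhoE; rewrite restrict_class_conj /pillow; congr conj_class.
apply: rep_ext; apply: morph_presented_ext => x.
rewrite [RHS](pres_lift_gen (pillow_subproof gt)) -rhoE; congr (rho _).
exact: (pres_lift_gen (@incl_subproof p q r)).
Qed.

End Representations.

Theorem theorem5p1 (R : realType) (p q r : int)
    (p_even : (2 %| p)%Z) (q_odd : ~~ (2 %| q)%Z) (r_odd : ~~ (2 %| r)%Z) :
  restrict_class R @` Rn_Y0 R p q r `<=`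
    (@pillow R @` [set gt | gt.2 = gt.1 * (r + 1)%:~R]) `|`
    (@pillow R @` [set gt | gt.2 = gt.1 * (r + 1)%:~R + pi]).
Proof.
move=> _ [_ [[rho0 rho0T <-] rho0N] <-].
have M0 y : [set gen (y0_rels p q r) Ya; gen (y0_rels p q r) Yb] y -> qre (rho0 y) = 0.
  by move=> yM; apply: rho0T; exists y, 1%g; split; [|left; rewrite conjg1].
have a0 := M0 _ (or_introl erefl); have b0 := M0 _ (or_intror erefl).
have [ba pq qr] := pi1_Y0_relations (morph_satisfies_rels rho0).
have [c0 d0 z0] := traceless_generators p_even q_odd r_odd ba pq qr a0 b0.
have [|g [s [t [ai bs ct]]]] := pillowcase_position a0 b0 c0.
  by rewrite -mulgA ba mulKg.
pose rho : rep R (pi1_Y0 p q r) := conj_fun rho0 g.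
rewrite -(conj_class_conj rho0 g) -/rho.
move: rho0N; rewrite -(conj_class_conj rho0 g) -/rho => rhoN.
have {ba pq qr} [ba pq qr] := pi1_Y0_relations (morph_satisfies_rels rho).
pose rg x := rho (gen (y0_rels p q r) x).
have rz0 : qre (rg Yz) = 0 by rewrite qreJ.
have ds := pillow_d ba ai bs.
have z3 : qk (rg Yz) != 0.
  apply/eqP => z3; apply: rhoN; exists rho => //.
  apply: circij_gens_binary_dihedral; case.
  - by rewrite [rho _]ai; apply/circijP.
  - by rewrite [rho _]bs; exists s.
  - by rewrite [rho _]ct; exists t.
  - by rewrite (ds _ ct); exists (t - s).
  - exact/circijP.
(* [theta] is only determined modulo [2 pi]: any angle [u] of the same point
   of the circle gives the same point of the pillowcase. *)
have on_pillow u : circij t = circij u ->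
    restrict_class R (conj_class rho) = pillow (s, u).
  move=> tu; have cu : rg Yc = circij u by rewrite -tu.
  apply: restrict_class_pillow; case; rewrite /= ?expk_mul_i //.
  exact: ds.
have := sin_right_column_angle ba pq qr ai bs ct rz0 z3.
case/sin0_circij => /on_pillow ->; [left|right].
  by exists (s, s * (r + 1)%:~R).
by exists (s, s * (r + 1)%:~R + pi).
Qed.
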